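(* Let $M\in\mathbb{F}_2^{m\times n}$ and let $s$ be the linear circuit complexity of $M$. Then $\mathbb{R}_M(\lfloor s/4\rfloor)\le 16$.
   Context: A linear circuit is a Boolean circuit (directed acyclic graph with input nodes and fan-in-2 internal gates) all of whose internal gates are XOR ($\oplus$) gates; its input nodes are $x_1,\dots,x_n$ and the constant $0$. It has $m$ designated output gates, and it computes $M$ if for all $x\in\{0,1\}^n$ its $i$-th output equals the $i$-th coordinate of $Mx$ over $\mathbb{F}_2$. The linear circuit complexity of $M$ is the minimum number of internal gates of a linear circuit computing $M$. A matrix is $t$-sparse if each of its rows has at most $t$ nonzero entries. The rigidity of $M$ for rank $r$ is $\mathbb{R}_M(r)=\min\{t : \exists\, A\in\{0,1\}^{m\times n}\ t\text{-sparse with } \operatorname{rank}_{\mathbb{F}_2}(M\oplus A)\le r\}$. *)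

(* Defs.v *)
From HB Require Import structures.
From mathcomp Require Import all_boot all_order all_algebra.
From mathcomp Require Import boolp.
Set Implicit Arguments.
Unset Strict Implicit.
Unset Printing Implicit Defensive.
Import GRing.Theory.
Local Open Scope ring_scope.

(* The nodes of a circuit on n variables with internal gates G:
   [inl (Some i)] is the variable x_i, [inl None] is the constant 0,
   [inr g] is the internal gate g. *)
Definition node (n : nat) (G : finType) : finType := (option 'I_n + G)%type.

Definition edge (n : nat) (G : finType) (l r : G -> node n G) : rel (node n G) :=
  fun u v => if v is inr g then (u == l g) || (u == r g) else false.

Definition acyclic (T : Type) (e : rel T) : Prop :=
  forall c : seq T, cycle e c -> c = [::].

(* As usual, any node (possibly an input node) may be designated as an output,
   and the two wires entering a gate may come from the same node. *)
Record linear_circuit (n m : nat) : Type := LinearCircuit {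
  gate : finType;
  lwire : gate -> node n gate;
  rwire : gate -> node n gate;
  output : 'I_m -> node n gate;
  circuit_acyclic : acyclic (edge lwire rwire)
}.

Definition circuit_size (n m : nat) (C : linear_circuit n m) : nat := #|gate C|.

(* [v] gives the values carried by the nodes of C on input x; there is exactly
   one such v, see [evaluation_exists] and [evaluation_unique]. *)
Definition evaluation (n m : nat) (C : linear_circuit n m) (x : 'cV['F_2]_n)
    (v : node n (gate C) -> 'F_2) : Prop :=
  [/\ forall i : 'I_n, v (inl (Some i)) = x i ord0,
      v (inl None) = 0
    & forall g : gate C, v (inr g) = v (lwire g) + v (rwire g)].

Definition computes (n m : nat) (C : linear_circuit n m) (M : 'M['F_2]_(m, n)) : Prop :=
  forall (x : 'cV['F_2]_n) (v : node n (gate C) -> 'F_2),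
    evaluation x v -> forall i : 'I_m, v (output C i) = (M *m x) i ord0.

Definition has_circuit_of_size (m n : nat) (M : 'M['F_2]_(m, n)) (s : nat) : Prop :=
  exists C : linear_circuit n m, circuit_size C = s /\ computes C M.

Definition ancestors (T : finType) (e : rel T) (u : T) : {set T} :=
  [set w | connect e w u].

Lemma ancestors_lt (T : finType) (e : rel T) (u v : T) :
  acyclic e -> e u v -> (#|ancestors e u| < #|ancestors e v|)%N.
Proof.
move=> ace euv; apply: proper_card; apply/properP; split.
  apply/subsetP => w; rewrite !inE => wu.
  exact: connect_trans wu (connect1 euv).
exists v; rewrite !inE ?connect0 //; apply/negP => /connectP [p pp lp].
have := ace (v :: p); rewrite /= rcons_path pp -lp euv.
by move=> /(_ isT).
Qed.

Lemma ancestors_gt0 (T : finType) (e : rel T) (u : T) : (0 < #|ancestors e u|)%N.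
Proof. by apply/card_gt0P; exists u; rewrite inE connect0. Qed.

Lemma evaluation_unique (n m : nat) (C : linear_circuit n m) (x : 'cV['F_2]_n)
    (v w : node n (gate C) -> 'F_2) :
  evaluation x v -> evaluation x w -> v =1 w.
Proof.
case=> v1 v0 vg [w1 w0 wg].
have ac := @circuit_acyclic _ _ C.
set e := edge _ _ in ac.
suff H k u : (#|ancestors e u| <= k)%N -> v u = w u by move=> u; apply: H (leqnn _).
elim: k u => [|k IH] u; first by rewrite leqNgt ancestors_gt0.
case: u => [[i|]|g] le; rewrite ?v1 ?w1 ?v0 ?w0 // vg wg; congr (_ + _);
  apply: IH; rewrite -ltnS; apply: leq_trans le; apply: ancestors_lt => //;
  by rewrite /e /= eqxx ?orbT.
Qed.

Lemma evaluation_exists (n m : nat) (C : linear_circuit n m) (x : 'cV['F_2]_n) :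
  exists v : node n (gate C) -> 'F_2, evaluation x v.
Proof.
have ac := @circuit_acyclic _ _ C.
set e := edge _ _ in ac.
pose step (v : node n (gate C) -> 'F_2) (u : node n (gate C)) : 'F_2 :=
  match u with
  | inl (Some i) => x i ord0
  | inl None => 0
  | inr g => v (lwire g) + v (rwire g)
  end.
pose V k := iter k step (fun=> 0).
have stab k u : (#|ancestors e u| <= k)%N -> V k.+1 u = V k u.
  elim: k u => [|k IH] u; first by rewrite leqNgt ancestors_gt0.
  case: u => [[i|]|g] le //.
  rewrite [LHS]/= [RHS]/= -/(V k.+1) -/(V k); congr (_ + _);
    apply: IH; rewrite -ltnS; apply: leq_trans le; apply: ancestors_lt => //;
    by rewrite /e /= eqxx ?orbT.
pose N := #|node n (gate C)|.
exists (V N.+1); split => // g.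
by rewrite -(stab N.+1) //; apply: leq_trans (max_card _) _.
Qed.

Lemma acyclic_rank (T : Type) (e : rel T) (f : T -> nat) :
  (forall u v, e u v -> (f u < f v)%N) -> acyclic e.
Proof.
move=> fe [//|u p] /= /(@homo_path _ _ f e ltn _ _ fe).
rewrite map_rcons => /(order_path_min ltn_trans) /allP /(_ (f u)).
by rewrite mem_rcons mem_head ltnn => /(_ isT).
Qed.

Lemma has_circuit (m n : nat) (M : 'M['F_2]_(m, n)) :
  exists s : nat, `[< has_circuit_of_size M s >].
Proof.
pose G : finType := ('I_m * 'I_n.+1)%type.
pose l (g : G) : node n G :=
  if g.2 is Ordinal k.+1 _ then inr (g.1, inord k) else inl None.
pose r (g : G) : node n G :=
  if unlift ord0 g.2 is Some j then
    if M g.1 j == 0 then inl None else inl (Some j)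
  else inl None.
have ac : acyclic (edge l r).
  pose f (u : node n G) : nat := if u is inr g then (g.2 : nat).+1 else 0%N.
  apply: (@acyclic_rank _ _ f).
  move=> u [//|[i [k kn]]] /= /orP [] /eqP ->; rewrite /l /r /=.
    by case: k kn => [//|k] kn /=; rewrite inordK // ltnW.
  by case: unlift => [j|//]; case: ifP.
exists #|G|; apply/asboolP.
exists (@LinearCircuit n m G l r (fun i => inr (i, ord_max)) ac); split => //.
move=> x v [vx v0 vg] i.
have key k (kn : (k < n.+1)%N) :
    v (inr (i, Ordinal kn)) = \sum_(j < n | (j < k)%N) M i j * x j ord0.
  elim: k kn => [|k IH] kn; rewrite vg /=.
    have ->: Ordinal kn = ord0 by apply: val_inj.
    by rewrite /l /r /= unlift_none v0 addr0 big_pred0.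
  have kn' : (k < n)%N by [].
  have ->: Ordinal kn = lift ord0 (Ordinal kn') by apply: val_inj.
  rewrite [r _]/r /= liftK /l /=.
  have ->: inord k = Ordinal (ltnW kn) by apply: val_inj; rewrite /= inordK // ltnW.
  rewrite IH [RHS](bigD1 (Ordinal kn')) /=; last exact: ltnSn.
  rewrite [RHS]addrC; congr (_ + _); last first.
    case: (eqVneq (M i (Ordinal kn')) 0) => [->|Mn0]; first by rewrite v0 mul0r.
    rewrite vx; suff -> : M i (Ordinal kn') = 1 by rewrite mul1r.
    by move: (M _ _) Mn0 => [[|[|]] //= ?] _; apply: val_inj.
  apply: eq_bigl => j; rewrite ltnS -val_eqE /= andbC.
  exact: ltn_neqAle.
rewrite /= /ord_max key mxE; apply: eq_bigl => j; exact: ltn_ord.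
Qed.

Definition linear_circuit_complexity (m n : nat) (M : 'M['F_2]_(m, n)) : nat :=
  ex_minn (has_circuit M).

Definition sparse (m n : nat) (t : nat) (A : 'M['F_2]_(m, n)) : bool :=
  [forall i : 'I_m, (#|[set j : 'I_n | A i j != 0%R]| <= t)%N].

Definition rigid_le (m n : nat) (M : 'M['F_2]_(m, n)) (r t : nat) : bool :=
  [exists A : 'M['F_2]_(m, n), sparse t A && (\rank (M + A)%R <= r)%N].

Lemma rigid_le_exists (m n : nat) (M : 'M['F_2]_(m, n)) (r : nat) :
  exists t : nat, rigid_le M r t.
Proof.
exists n; apply/existsP; exists (- M); rewrite subrr mxrank0 leq0n andbT.
by apply/forallP => i; rewrite -[leqRHS]card_ord max_card.
Qed.

Definition rigidity (m n : nat) (M : 'M['F_2]_(m, n)) (r : nat) : nat :=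
  ex_minn (rigid_le_exists M r).

(* Main.v *)
(** Repeatedly enlarge a space W of linear forms, starting from 0, so that each
    new dimension deletes at least four gates of a circuit computing M modulo W.
    Outputs that are already sums of at most 16 variables modulo W are forgotten,
    and unused gates are dropped; hence a gate of depth at most 4 has a user. While
    an output remains, some gate g4 has depth exactly 4, with wires g2 -> g3 -> g4
    coming from gates of depth 2 and 3. If g = g2 or g = g3 has two users, put its value
    into W: this deletes g, both users, and one of the two wires of g, which have
    become equal. Otherwise put the value of g4 into W: this deletes g4, a user
    of g4, and also g3 and g2, which were needed only for g4. When no output is
    left, every row of M is 16-sparse modulo W, and dim W <= s / 4. *)
Require Import Defs.
From mathcomp Require Import all_boot all_order all_algebra.
From mathcomp Require Import boolp.
Set Implicit Arguments.
Unset Strict Implicit.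
Unset Printing Implicit Defensive.
Import GRing.Theory.

(** * Row vectors that are sparse modulo a row space *)

Section SparseModulo.
Local Open Scope ring_scope.
Context {n : nat}.
Implicit Types (W : 'M['F_2]_n) (a b c v w : 'rV['F_2]_n).

Definition support a : {set 'I_n} := [set j | a ord0 j != 0].

Definition sparse_mod W (t : nat) v :=
  [exists a, (#|support a| <= t)%N && (v - a <= W)%MS].

Lemma rowF2_opp v : - v = v.
Proof.
by apply/rowP => j; rewrite !mxE; case: (v _ _) => [[|[|]] // ?]; apply: val_inj.
Qed.

Lemma submx_sub_trans W a b c :
  (a - b <= W)%MS -> (b - c <= W)%MS -> (a - c <= W)%MS.
Proof. by move=> ab bc; rewrite -(subrKA b) addmx_sub. Qed.

Lemma support_add a b : (#|support (a + b)| <= #|support a| + #|support b|)%N.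
Proof.
apply: leq_trans (leq_card_setU _ _); apply/subset_leq_card/subsetP => j.
by rewrite !inE mxE; case: (eqVneq (a ord0 j) 0) => // ->; rewrite add0r.
Qed.

Lemma sparse_mod_add W s t v w :
  sparse_mod W s v -> sparse_mod W t w -> sparse_mod W (s + t) (v + w).
Proof.
move=> /existsP [a /andP [sa va]] /existsP [b /andP [tb wb]].
apply/existsP; exists (a + b); apply/andP; split.
  exact: leq_trans (support_add _ _) (leq_add sa tb).
by rewrite opprD addrACA addmx_sub.
Qed.

Lemma sparse_mod_congr W t v w :
  (v - w <= W)%MS -> sparse_mod W t w -> sparse_mod W t v.
Proof.
move=> vw /existsP [a /andP [ta wa]]; apply/existsP; exists a.
by rewrite ta (submx_sub_trans vw wa).
Qed.

Lemma sparse_mod_sub W W' t v :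
  (W <= W')%MS -> sparse_mod W t v -> sparse_mod W' t v.
Proof.
move=> WW' /existsP [a /andP [ta va]]; apply/existsP; exists a.
by rewrite ta (submx_trans va WW').
Qed.

End SparseModulo.

(** * Circuits that are correct modulo a row space, and their rewiring *)

Section CircuitModulo.
Local Open Scope ring_scope.
Context {n : nat} {G : finType}.
Implicit Types (S K : {set G}) (l r : G -> node n G) (W : 'M['F_2]_n).
Implicit Types (u : node n G) (g h : G) (O : {set node n G}).

Definition available S u := if u is inr g then g \in S else true.

(** Recursion runs on the bound [k], not along the wires, so it is structural for any wiring. *)
Fixpoint depth_le l r (k : nat) u : bool :=
  if u is inr g then
    if k is k'.+1 then depth_le l r k' (l g) && depth_le l r k' (r g) else false
  else true.

Lemma deep_wire l r k g :
  ~~ depth_le l r k.+1 (inr g) ->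
  exists2 u, edge l r u (inr g) & ~~ depth_le l r k u.
Proof.
rewrite /= negb_and => /orP [] d; [exists (l g) | exists (r g)] => //=;
  by rewrite eqxx ?orbT.
Qed.

Lemma depth_le_wire l r k g u :
  depth_le l r k.+1 (inr g) -> edge l r u (inr g) -> depth_le l r k u.
Proof. by move=> /= /andP [dl dr] /orP [] /eqP ->. Qed.

Lemma depth_leS l r k u : depth_le l r k u -> depth_le l r k.+1 u.
Proof. by elim: k u => [|k IH] [i|g] //= /andP [/IH /= -> /IH /= ->]. Qed.

Context (phi : node n G -> 'rV['F_2]_n) (rho : node n G -> nat).
Context (phi_input : forall i, (#|support (phi (inl i))| <= 1)%N).
Context (phi_zero : phi (inl None) = 0).
Context (rho_input : forall i u, (rho (inl i) <= rho u)%N).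

(* A circuit on the gates S whose gates compute the fixed values phi only up to
   the row space of W; the rank rho bounds every rewiring. *)
Definition circuit_mod S l r W :=
  forall g, g \in S ->
    (phi (inr g) - (phi (l g) + phi (r g)) <= W)%MS /\
    forall u, edge l r u (inr g) -> available S u /\ (rho u < rho (inr g))%N.

(** The rank condition keeps a rewired circuit acyclic; the congruence keeps its gate equations true
    modulo [W]. *)
Definition replaces K W u u' :=
  [&& available K u', (rho u' <= rho u)%N & (phi u - phi u' <= W)%MS].

Lemma replaces_refl K W u : available K u -> replaces K W u u.
Proof. by move=> Ku; rewrite /replaces Ku leqnn subrr sub0mx. Qed.

Lemma replaces_zero K W u : (phi u <= W)%MS -> replaces K W u (inl None).
Proof. by move=> uW; rewrite /replaces /= rho_input phi_zero subr0. Qed.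

Lemma replaces_le K W u v u' :
  (rho v <= rho u)%N -> (phi u - phi v <= W)%MS ->
  replaces K W v u' -> replaces K W u u'.
Proof.
move=> vu uv /and3P [K' u'v vu']; rewrite /replaces K' (leq_trans u'v vu).
exact: submx_sub_trans uv vu'.
Qed.

(** Each level of gates at most doubles the support; depth 4 gives the constant 16. *)
Lemma depth_le_sparse S l r W k u :
  circuit_mod S l r W -> available S u -> depth_le l r k u ->
  sparse_mod W (2 ^ k) (phi u).
Proof.
move=> cS; elim: k u => [|k IH] [i|g] //=.
- by move=> _ _; apply/existsP; exists (phi (inl i)); rewrite phi_input subrr sub0mx.
- move=> _ _; apply/existsP; exists (phi (inl i)); rewrite subrr sub0mx andbT.
  by apply: leq_trans (phi_input i) _; rewrite expn_gt0.
move=> gS /andP [dl dr]; have [gW wires] := cS g gS.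
apply: sparse_mod_congr gW _; rewrite expnS mul2n -addnn.
have lS : available S (l g) by have [] := wires (l g); rewrite //= eqxx.
have rS : available S (r g) by have [] := wires (r g); rewrite //= eqxx orbT.
by apply: sparse_mod_add; apply: IH.
Qed.

Lemma other_wire S l r W g u :
  circuit_mod S l r W -> g \in S -> l g != r g -> edge l r u (inr g) ->
  exists j, [/\ edge l r j (inr g), j != u & (phi (inr g) - (phi u + phi j) <= W)%MS].
Proof.
move=> cS gS lr; have [gW _] := cS g gS.
case/orP => /eqP ->; [exists (r g) | exists (l g)]; split; rewrite //= ?eqxx ?orbT //.
  by rewrite eq_sym.
by rewrite [phi (r g) + _]addrC.
Qed.

Lemma sub_of_sum W g u j :
  (phi (inr g) - (phi u + phi j) <= W)%MS -> (phi u <= W)%MS ->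
  (phi (inr g) - phi j <= W)%MS.
Proof.
move=> gW uW; apply: submx_sub_trans gW _.
by rewrite addrK.
Qed.

(** Redirect each wire of a kept gate to a replacement of its source. The two errors lie in [W'],
    hence so does their sum, and the ranks of the sources do not grow. *)
Lemma collapse S K l r W W' :
  circuit_mod S l r W -> K \subset S -> (W <= W')%MS ->
  (forall g u, g \in K -> edge l r u (inr g) -> exists u', replaces K W' u u') ->
  exists l' r', circuit_mod K l' r' W'.
Proof.
move=> cS /subsetP KS WW' rep.
(* The default [u] is reached only at nodes that feed no gate of [K]. *)
pose f u := odflt u [pick u' | replaces K W' u u'].
have fP g u : g \in K -> edge l r u (inr g) -> replaces K W' u (f u).
  move=> gK /(rep _ _ gK) [u' uu']; rewrite /f; case: pickP => //= /(_ u').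
  by rewrite uu'.
exists (f \o l), (f \o r) => g gK.
have [gW wires] := cS g (KS g gK).
have el : edge l r (l g) (inr g) by rewrite /= eqxx.
have er : edge l r (r g) (inr g) by rewrite /= eqxx orbT.
have /and3P [al rl pl] := fP g _ gK el; have /and3P [ar rr pr] := fP g _ gK er.
split; last first.
  move=> u /= /orP [] /eqP ->; split=> //.
    exact: leq_ltn_trans rl (wires _ el).2.
  exact: leq_ltn_trans rr (wires _ er).2.
apply: submx_sub_trans (submx_trans gW WW') _.
by rewrite opprD addrACA addmx_sub.
Qed.

Lemma rank_adds_row W v : (\rank (W + (v : 'rV['F_2]_n))%MS <= (\rank W).+1)%N.
Proof.
apply: leq_trans (mxrank_adds_leqif W v) _.
by rewrite -[leqRHS]addn1 leq_add2l rank_leq_row.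
Qed.

(* Adding phi g to W deletes g itself, its two users, which now duplicate their
   other wires, and the higher-ranked of the two wires of g, which now agree. *)
Lemma collapse_branching S l r W g h1 h2 :
  circuit_mod S l r W -> (forall g, g \in S -> l g != r g) ->
  g \in S -> ~~ depth_le l r 1 (inr g) ->
  h1 \in S -> h2 \in S -> h1 != h2 ->
  edge l r (inr g) (inr h1) -> edge l r (inr g) (inr h2) ->
  exists K, (#|K| + 4 <= #|S|)%N /\ K \subset S /\
    forall u, available S u -> exists u', replaces K (W + phi (inr g))%MS u u'.
Proof.
move=> cS lr gS dg h1S h2S h12 e1 e2.
set W' := (W + _)%MS.
have WW' : (W <= W')%MS by apply: addsmxSl.
have gW' : (phi (inr g) <= W')%MS by apply: addsmxSr.
(* Since [g] has depth above 1, one of its wires is a gate. In characteristic 2 its wires, whose sum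
   lies in [W'], agree modulo [W']; [c] is a gate of maximal rank among them and [d] takes its
   place. *)
have [c [d [cS' cg [dS dc dg'] dcr cd]]] : exists c d,
    [/\ c \in S, (rho (inr c) < rho (inr g))%N,
        [/\ available S d, d != inr c & (rho d < rho (inr g))%N],
        (rho d <= rho (inr c))%N & (phi (inr c) - phi d <= W')%MS].
  have [a ea da] := deep_wire dg.
  have [b [eb ba gab]] := other_wire cS gS (lr _ gS) ea.
  have [_ wires] := cS g gS.
  have [aS ag] := wires _ ea; have [bS bg] := wires _ eb.
  have ab : (phi a - phi b <= W')%MS.
    have -> : phi a - phi b = phi (inr g) - (phi (inr g) - (phi a + phi b)).
      by rewrite opprB addrCA subrr addr0 [- phi b]rowF2_opp.
    by rewrite addmx_sub // rowF2_opp (submx_trans gab).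
  have ba' : (phi b - phi a <= W')%MS by rewrite -[_ - _]rowF2_opp opprB.
  case: a da {ea gab} aS ag ba ba' ab => [//|a] _ /= aS ag ba ba' ab.
  case: b {eb} bS bg ba ba' ab => [i|b] bS bg ba ba' ab.
    by exists a, (inl i); split=> //; apply: rho_input.
  case: (leqP (rho (inr b)) (rho (inr a))) => rab.
    by exists a, (inr b).
  by exists b, (inr a); split; rewrite 1?eq_sym // ltnW.
have [j1 [ej1 _ pj1]] := other_wire cS h1S (lr _ h1S) e1.
have [j2 [ej2 _ pj2]] := other_wire cS h2S (lr _ h2S) e2.
have [_ w1] := cS h1 h1S; have [_ w2] := cS h2 h2S.
have [_ g1] := w1 _ e1; have [_ g2] := w2 _ e2.
have [j1S j1h] := w1 _ ej1; have [j2S j2h] := w2 _ ej2.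
pose D := c |: (g |: (h1 |: [set h2])).
have lt_neq x y : (rho (inr x) < rho (inr y))%N -> x != y.
  by apply: contraTneq => ->; rewrite ltnn.
have D4 : #|D| = 4%N.
  rewrite /D !cardsU1 cards1 !inE (negbTE h12).
  by rewrite !(negbTE (lt_neq _ _ _)) //; apply: ltn_trans cg _.
have DS : D \subset S.
  by apply/subsetP => x; rewrite !inE => /or4P [] /eqP ->.
exists (S :\: D); split; first by rewrite -D4 cardsDS // subnK // subset_leq_card.
split=> [|u]; first exact: subsetDl.
(* Induction on the rank: the other wire of [h1] or [h2] may itself be deleted, and then its own
   replacement is used. *)
have [k] := ubnP (rho u); elim: k u => // k IH u uk uS.
have via j h : available S j -> (rho j < rho (inr h))%N -> (rho (inr h) < k.+1)%N ->
    (phi (inr h) - (phi (inr g) + phi j) <= W)%MS ->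
    exists u', replaces (S :\: D) W' (inr h) u'.
  move=> jS jh hk pj; have [u' ju'] := IH j (leq_trans jh hk) jS.
  exists u'; apply: replaces_le (ltnW jh) _ ju'.
  by apply: sub_of_sum gW'; apply: submx_trans WW'.
case: u uS uk => [i|x] /= xS xk; first by exists (inl i); apply: replaces_refl.
have [xD|xD] := boolP (x \in D); last first.
  by exists (inr x); apply: replaces_refl; rewrite /= inE xD.
move: xD; rewrite !inE => /or4P [] /eqP xE; subst x.
(* [d] survives, being different from [c] and of lower rank than [g], [h1] and [h2]. *)
- exists d; rewrite /replaces dcr cd !andbT.
  case: (d) dS dg' dc => //= y yS yg yc; rewrite !inE yS andbT !negb_or.
  by rewrite (inj_eq inr_inj) in yc; rewrite yc !lt_neq // (ltn_trans yg).
- by exists (inl None); apply: replaces_zero.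
- exact: via pj1.
- exact: via pj2.
Qed.

(* Adding phi g4 to W deletes g4, the gates g3 and g2, which serve no other
   purpose, and the user h of g4. *)
Lemma collapse_chain S l r W g2 g3 g4 h :
  circuit_mod S l r W -> (forall g, g \in S -> l g != r g) ->
  g2 \in S -> g3 \in S -> g4 \in S -> h \in S ->
  edge l r (inr g2) (inr g3) -> edge l r (inr g3) (inr g4) ->
  edge l r (inr g4) (inr h) ->
  (forall x, x \in S -> edge l r (inr g2) (inr x) -> x = g3) ->
  (forall x, x \in S -> edge l r (inr g3) (inr x) -> x = g4) ->
  exists K, [/\ (#|K| + 4 <= #|S|)%N, K \subset S, g3 \notin K, g4 \notin K &
    forall u, available S u -> u != inr g2 -> u != inr g3 ->
      exists u', replaces K (W + phi (inr g4))%MS u u'].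
Proof.
move=> cS lr g2S g3S g4S hS e23 e34 e4h only2 only3.
set W' := (W + _)%MS.
have WW' : (W <= W')%MS by apply: addsmxSl.
have gW' : (phi (inr g4) <= W')%MS by apply: addsmxSr.
have [_ r23] := (cS g3 g3S).2 _ e23.
have [_ r34] := (cS g4 g4S).2 _ e34.
have [_ r4h] := (cS h hS).2 _ e4h.
have lt_neq x y : (rho (inr x) < rho (inr y))%N -> x != y.
  by apply: contraTneq => ->; rewrite ltnn.
have [j [ejh j4 pj]] := other_wire cS hS (lr _ hS) e4h.
have [jS jh] := (cS h hS).2 _ ejh.
pose D := g2 |: (g3 |: (g4 |: [set h])).
have r24 := ltn_trans r23 r34; have r3h := ltn_trans r34 r4h.
have D4 : #|D| = 4%N.
  rewrite /D !cardsU1 cards1 !inE.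
  by rewrite !(negbTE (lt_neq _ _ _)) //; apply: ltn_trans r23 _.
have DS : D \subset S.
  by apply/subsetP => x; rewrite !inE => /or4P [] /eqP ->.
exists (S :\: D); split; rewrite ?inE ?eqxx ?orbT //.
- by rewrite -D4 cardsDS // subnK // subset_leq_card.
- exact: subsetDl.
have keep u : available S u -> u != inr g2 -> u != inr g3 -> u != inr g4 -> u != inr h ->
    replaces (S :\: D) W' u u.
  move=> uS u2 u3 u4 uh; apply: replaces_refl; case: u uS u2 u3 u4 uh => //= x xS.
  by rewrite !(inj_eq inr_inj) !inE xS => /negbTE -> /negbTE -> /negbTE -> /negbTE ->.
move=> u uS u2 u3.
have [->|u4] := eqVneq u (inr g4); first by exists (inl None); apply: replaces_zero.
have [->|uh] := eqVneq u (inr h); last by exists u; apply: keep.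
(* The other wire [j] of [h] survives: [g2] feeds only [g3] and [g3] only [g4], and both users have
   lower rank than [h]. *)
exists j; apply: replaces_le (ltnW jh) _ _.
  by apply: sub_of_sum gW'; apply: submx_trans WW'.
apply: keep => //.
- apply: contraTneq ejh => ->; apply/negP => /only2 - /(_ hS) hE.
  by move: r3h; rewrite hE ltnn.
- apply: contraTneq ejh => ->; apply/negP => /only3 - /(_ hS) hE.
  by move: r4h; rewrite hE ltnn.
- by apply: contraTneq jh => ->; rewrite ltnn.
Qed.

(** * Reduction steps and the induction on the number of gates *)

(** The potential [\rank W + #|S| %/ 4] does not grow, which gives the final rank bound; [#|S|]
    drops, which gives termination. *)
Definition reducible S W O :=
  exists K l' r' W', [/\ circuit_mod K l' r' W', (W <= W')%MS, (#|K| < #|S|)%N,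
    (\rank W' + #|K| %/ 4 <= \rank W + #|S| %/ 4)%N &
    forall u, u \in O -> exists u', replaces K W' u u'].

Lemma reducible_free S l r W O g :
  circuit_mod S l r W -> g \in S ->
  (forall x u, x \in S :\ g -> edge l r u (inr x) -> exists u', replaces (S :\ g) W u u') ->
  (forall u, u \in O -> exists u', replaces (S :\ g) W u u') ->
  reducible S W O.
Proof.
move=> cS gS repS repO.
have [l' [r' cK]] := collapse cS (subD1set _ _) (submx_refl _) repS.
have SK := cardsD1 g S; rewrite gS in SK.
exists (S :\ g), l', r', W; split=> //; first by rewrite SK.
by rewrite leq_add2l leq_div2r // SK leq_addl.
Qed.

(** Four deleted gates lower [#|S| %/ 4] by at least one, which pays for the new dimension. *)
Lemma reducible_four S l r W O K (v : 'rV['F_2]_n) :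
  circuit_mod S l r W -> (#|K| + 4 <= #|S|)%N -> K \subset S ->
  (forall x u, x \in K -> edge l r u (inr x) -> exists u', replaces K (W + v)%MS u u') ->
  (forall u, u \in O -> exists u', replaces K (W + v)%MS u u') ->
  reducible S W O.
Proof.
move=> cS K4 KS repS repO.
have [l' [r' cK]] := collapse cS KS (addsmxSl W v) repS.
exists K, l', r', (W + v)%MS; split=> //; first exact: addsmxSl.
  by apply: leq_trans K4; rewrite -addn1 leq_add2l.
apply: leq_trans (leq_add (rank_adds_row W v) (leqnn _)) _.
rewrite addSn -addnS leq_add2l.
by apply: leq_trans (leq_div2r 4 K4); rewrite divnDr // divnn addn1.
Qed.

Lemma reducible_nonsparse S l r W O :
  circuit_mod S l r W -> O != set0 ->
  (forall u, u \in O -> available S u /\ ~~ sparse_mod W 16 (phi u)) ->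
  reducible S W O.
Proof.
move=> cS On0 OS.
have shallow u : available S u -> depth_le l r 4 u -> u \notin O.
  move=> uS du; apply/negP => /OS [_ /negP]; apply.
  exact: (depth_le_sparse cS uS du).
(* A gate with equal wires is 0 modulo [W], so the constant 0 replaces it. Afterwards all gates have
   distinct wires. *)
have [/exists_inP [g gS /eqP lrg]|] := boolP [exists g in S, l g == r g].
  have rep u : available S u -> exists u', replaces (S :\ g) W u u'.
    have [-> _|ug uS] := eqVneq u (inr g).
      exists (inl None); apply: replaces_zero.
      by have [] := cS g gS; rewrite lrg -{1}[phi (r g)]rowF2_opp addNr subr0.
    exists u; apply: replaces_refl; case: u ug uS => //= x.
    by rewrite (inj_eq inr_inj) !inE => -> ->.
  apply: (reducible_free cS gS) => [x u /setD1P [_ xS] /((cS x xS).2 u) []|u /OS []] *;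
    exact: rep.
rewrite negb_exists_in => /forall_inP lr.
pose used g := [exists h in S, edge l r (inr g) (inr h)].
have [/exists_inP [g gS /andP [gO ng]]|] := boolP [exists g in S, (inr g \notin O) && ~~ used g].
  have rep u : available S u -> u != inr g -> exists u', replaces (S :\ g) W u u'.
    move=> uS ug; exists u; apply: replaces_refl; case: u ug uS => //= x.
    by rewrite (inj_eq inr_inj) !inE => -> ->.
  apply: (reducible_free cS gS) => [x u /setD1P [_ xS] eux|u uO].
    apply: rep; first by case: ((cS x xS).2 u eux).
    apply: contraNneq ng => ug; apply/exists_inP; exists x; by rewrite -?ug.
  apply: rep; first by case: (OS u uO).
  by apply: contraTneq uO => ->.
rewrite negb_exists_in => /forall_inP live.
have {live}usedP g : g \in S -> depth_le l r 4 (inr g) ->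
    exists2 h, h \in S & edge l r (inr g) (inr h).
  move=> gS dg; apply/exists_inP; have := live g gS.
  by rewrite (shallow (inr g)) //= negbK.
(* A node of [O] has depth above 4, so gates of depth above 3 exist. One of least rank has wires of
   depth at most 3, hence depth exactly 4. *)
have [g0 g0S dg0] : exists2 g, g \in S & ~~ depth_le l r 3 (inr g).
  have /set0Pn [u uO] := On0; have [uS _] := OS u uO.
  have := shallow u uS; rewrite uO; case: u {uO} uS => [i _ /(_ isT)//|g gS ng].
  by exists g => //; apply/negP => dg; have := ng (depth_leS dg).
have [g4 /andP [g4S d4] min4] :=
  arg_minnP (P := fun g => (g \in S) && ~~ depth_le l r 3 (inr g))
    (fun g => rho (inr g)) (introT andP (conj g0S dg0)).
have wire_depth u : edge l r u (inr g4) -> depth_le l r 3 u.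
  move=> eu; have [uS ru] := (cS g4 g4S).2 u eu.
  apply: contraTT ru; case: u eu uS => [//|g] _ gS dg; rewrite -leqNgt min4 //.
  by apply/andP.
have d44 : depth_le l r 4 (inr g4).
  apply/andP; split; apply: wire_depth; by rewrite /= eqxx ?orbT.
have gateP k g : g \in S -> ~~ depth_le l r k.+1 (inr g) ->
    exists x, [/\ x \in S, edge l r (inr x) (inr g) & ~~ depth_le l r k (inr x)].
  move=> gS /deep_wire [[i|x] ex dx]; first by case: (k) dx.
  by exists x; split=> //; case: ((cS g gS).2 _ ex).
have [g3 [g3S e34 d3]] := gateP _ _ g4S d4.
have d33 := wire_depth _ e34.
have [g2 [g2S e23 d2]] := gateP _ _ g3S d3.
have d22 := depth_le_wire d33 e23.
have branching g h1 h2 : g \in S -> ~~ depth_le l r 1 (inr g) -> h1 \in S -> h2 \in S ->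
    edge l r (inr g) (inr h1) -> edge l r (inr g) (inr h2) -> h1 != h2 ->
    reducible S W O.
  move=> gS dg h1S h2S e1 e2 h12.
  have [K [K4 [KS rep]]] := collapse_branching cS lr gS dg h1S h2S h12 e1 e2.
  apply: (reducible_four cS K4 KS) => [x u xK /((cS x (subsetP KS x xK)).2 u) [] uS _|u /OS [] uS _];
    exact: rep.
have [/exists_inP [x xS /andP [ex nx]]|/exists_inPn only2] :=
    boolP [exists x in S, edge l r (inr g2) (inr x) && (x != g3)].
  exact: (branching g2 x g3).
have [/exists_inP [x xS /andP [ex nx]]|/exists_inPn only3] :=
    boolP [exists x in S, edge l r (inr g3) (inr x) && (x != g4)].
  by apply: (branching g3 x g4) => //; apply: contraNN d3; apply: depth_leS.
have {}only2 x : x \in S -> edge l r (inr g2) (inr x) -> x = g3.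
  by move=> xS ex; apply/eqP; have := only2 x xS; rewrite ex negbK.
have {}only3 x : x \in S -> edge l r (inr g3) (inr x) -> x = g4.
  by move=> xS ex; apply/eqP; have := only3 x xS; rewrite ex negbK.
have [h hS e4h] := usedP g4 g4S d44.
have [K [K4 KS n3 n4 rep]] :=
  collapse_chain cS lr g2S g3S g4S hS e23 e34 e4h only2 only3.
apply: (reducible_four cS K4 KS) => [x u xK eux|u uO].
  (* No kept gate reads [g2] or [g3], whose only users are deleted. *)
  have xS := subsetP KS x xK.
  apply: rep; first by case: ((cS x xS).2 u eux).
    by apply: contraNneq n3 => u2; rewrite -(only2 x) // -u2.
  by apply: contraNneq n4 => u3; rewrite -(only3 x) // -u3.
(* [g2] and [g3] are given no replacement, but they are too shallow to lie in [O]. *)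
have [uS _] := OS u uO.
apply: rep => //; apply: contraTneq uO => ->; apply: shallow => //.
  exact: depth_leS (depth_leS d22).
exact: depth_leS d33.
Qed.

Lemma sparsify S l r W O :
  circuit_mod S l r W -> (forall u, u \in O -> available S u) ->
  exists W', [/\ (W <= W')%MS, (\rank W' <= \rank W + #|S| %/ 4)%N &
    forall u, u \in O -> sparse_mod W' 16 (phi u)].
Proof.
have [k] := ubnP #|S|; elim: k S l r W O => // k IH S l r W O Sk cS OS.
pose O' := [set u in O | ~~ sparse_mod W 16 (phi u)].
have [O'0|O'n0] := eqVneq O' set0.
  exists W; split; rewrite ?leq_addr // => u uO.
  by have := in_set0 u; rewrite -O'0 inE uO /= => /negbFE.
have [|K [l' [r' [W1 [cK WW1 KS rk rep]]]]] := reducible_nonsparse cS O'n0.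
  by move=> u; rewrite inE => /andP [/OS].
(* Every node still available becomes a target, and the replacements of the old targets are among
   them. *)
have [|W2 [W12 rk2 sp]] :=
  IH K l' r' W1 [set u | available K u] (leq_trans KS Sk) cK.
  by move=> u; rewrite inE.
exists W2; split; first exact: submx_trans W12.
  exact: leq_trans rk2 rk.
move=> u uO; have [spu|nsp] := boolP (sparse_mod W 16 (phi u)).
  by apply: sparse_mod_sub spu; apply: submx_trans W12.
have [|u' /and3P [Ku' _ uu']] := rep u; first by rewrite inE uO.
by apply: sparse_mod_congr (submx_trans uu' W12) (sp u' _); rewrite inE.
Qed.

End CircuitModulo.

(** * From a linear circuit to a rigidity bound *)

(** The linear form of a node is read off on the standard basis: its coordinate [j] is the value of
    the node on the [j]-th unit vector. *)
Lemma circuit_rows (m n : nat) (C : linear_circuit n m) :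
  exists phi : node n (gate C) -> 'rV['F_2]_n,
    [/\ forall i, phi (inl (Some i)) = delta_mx ord0 i, phi (inl None) = 0%R,
        forall g, phi (inr g) = (phi (lwire g) + phi (rwire g))%R &
        forall M, computes C M -> forall i, phi (output C i) = row i M].
Proof.
have [v vP] := choice (fun j : 'I_n => evaluation_exists C (delta_mx j ord0)).
exists (fun u => \row_j v j u)%R; split.
- by move=> i; apply/rowP => j; have [vi _ _] := vP j; rewrite !mxE vi mxE !eqxx andbT eq_sym.
- by apply/rowP => j; have [_ v0 _] := vP j; rewrite !mxE v0.
- by move=> g; apply/rowP => j; have [_ _ vg] := vP j; rewrite !mxE vg.
move=> M CM i; apply/rowP => j; by rewrite !mxE (CM _ _ (vP j)) -colE mxE.
Qed.

Lemma rigid_le_of_circuit (m n : nat) (M : 'M['F_2]_(m, n)) (s : nat) :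
  has_circuit_of_size M s -> rigid_le M (s %/ 4) 16.
Proof.
case=> C [<- CM]; have [phi [phi_var phi0 phi_gate phi_out]] := circuit_rows C.
pose e := edge (@lwire _ _ C) (@rwire _ _ C).
(* The number of ancestors increases along wires; the value 0 gives inputs minimal rank. *)
pose rho (u : node n (gate C)) := if u is inr _ then #|ancestors e u| else 0.
have cC : circuit_mod phi rho setT (@lwire _ _ C) (@rwire _ _ C) 0%R.
  move=> g _; split; first by rewrite phi_gate subrr sub0mx.
  move=> u eu; split; first by case: u {eu} => //= x; rewrite inE.
  have := ancestors_lt (@circuit_acyclic _ _ C) eu.
  by case: u {eu} => [i|x] //= _; apply: ancestors_gt0.
have phi_input i : #|support (phi (inl i))| <= 1.
  case: i => [i|]; last by rewrite phi0 /support eq_card0 // => j; rewrite !inE mxE eqxx.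
  rewrite phi_var -[leqRHS](cards1 i); apply/subset_leq_card/subsetP => j.
  by rewrite !inE mxE eqxx /=; case: (j == i); rewrite /= ?eqxx.
have availT u : u \in [set: node n (gate C)] -> available setT u.
  by case: u => [i|g] //= _; rewrite inE.
have [W [_ rkW sp]] :=
  sparsify phi_input phi0 (fun i u => leq0n (rho u)) cC availT.
have {}sp (i : 'I_m) : exists a, (#|support a| <= 16) && ((row i M - a)%R <= W)%MS.
  by rewrite -phi_out //; apply/existsP/sp.
have [a aP] := choice sp.
(* Row [i] of the sparse matrix is the representative of row [i] of [M]. Over ['F_2] the sum of the
   two matrices is their difference, whose rows lie in [W]. *)
apply/existsP; exists (\matrix_i a i)%R; apply/andP; split.
  apply/forallP => i; have /andP [ai _] := aP i.
  by apply: leq_trans ai; apply/subset_leq_card/subsetP => j; rewrite !inE mxE.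
rewrite mxrank0 cardsT in rkW; apply: leq_trans rkW.
apply/mxrankS/row_subP => i; rewrite linearD /= rowK -[a i]rowF2_opp.
by have /andP [] := aP i.
Qed.

Theorem theorem2 (m n : nat) (M : 'M['F_2]_(m, n)) (s : nat)
  (hs : s = linear_circuit_complexity M) :
  rigidity M (s %/ 4) <= 16.
Proof.
move: hs; rewrite /linear_circuit_complexity; case: ex_minnP => s' /asboolP sM _ ->.
by rewrite /rigidity; case: ex_minnP => t _; apply; apply: rigid_le_of_circuit.
Qed.
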